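(* For all positive $\varepsilon$, there is a vector field $v\in L^2_0(\lambda)$ that satisfies the following: (1) $|v|_2\leqslant\varepsilon$; (2) $\mathscr{L}_2v=0$, so that $\lambda+\mathscr{L}_2v=\lambda$; and (3) $\mathrm{W}\big(\Phi_{2\#}(\lambda+v),\lambda\big)\geqslant c\,\varepsilon$, for some constant $c>0$ independent of $\varepsilon$ and $v$.
   Context: $\mathbb{S}^1=\mathbb{R}/\mathbb{Z}$, $\lambda$ is the Lebesgue probability measure, $\Phi_2(x)=2x\bmod1$ and $\Phi_{2\#}$ is push-forward of measures. $L^2_0(\lambda)=\{v\in L^2(\lambda;\mathbb{R}):\int v\,d\lambda=0\}$, and $|\cdot|_2$ is the $L^2(\lambda)$ norm. $\mathscr{L}_2:L^2_0(\lambda)\to L^2_0(\lambda)$ is the operator $\mathscr{L}_2v(x)=v(x/2)+v((x+1)/2)$. For $v\in L^2(\lambda)$, $\lambda+v:=(\mathrm{Id}+v)_\#\lambda$, the push-forward of $\lambda$ by $x\mapsto x+v(x)\bmod1$. $\mathrm{W}$ is the quadratic Wasserstein metric: $\mathrm{W}(\mu,\nu)=\left(\inf_\Pi\int d(x,y)^2\,\Pi(dx\,dy)\right)^{1/2}$, with $d$ the distance of $\mathbb{S}^1$ and the infimum over probability measures $\Pi$ on $\mathbb{S}^1\times\mathbb{S}^1$ with marginals $\mu,\nu$.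
   Formalization: Since W ≤ 1/2 on the circle, no c > 0 works for all ε > 0; the formal theorem claims the result for 0 < ε ≤ ε₀, for every ε₀ > 0, with c > 0 depending only on ε₀. *)

(* Defs.v *)
From HB Require Import structures.
From mathcomp Require Import all_boot all_order all_algebra.
From mathcomp Require Import ring lra zify.
From mathcomp Require Import all_classical all_reals all_analysis.
From mathcomp Require Import measurable_realfun.

Set Implicit Arguments.
Unset Strict Implicit.
Unset Printing Implicit Defensive.

Import Order.TTheory GRing.Theory Num.Theory.
Import numFieldNormedType.Exports.

Local Open Scope classical_set_scope.
Local Open Scope ring_scope.

(* The circle R/Z: the quotient of the additive group R by the subgroup
   [Num.int_num_subdef] of integral elements (the predicate underlying
   [Num.int]), with the quotient topology and its Borel sigma-algebra. *)
Definition circle (R : realType) : Type :=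
  Quotient.quot [the zmodClosed R of (@Num.int_num_subdef R : {pred R})].

HB.instance Definition _ (R : realType) := GRing.Zmodule.on (circle R).
HB.instance Definition _ (R : realType) := Quotient.on (circle R).

(* The source is written [measurableTypeR R], the copy of [R] that carries
   [lebesgue_measure]. *)
Definition circle_pi (R : realType) (a : measurableTypeR R) : circle R := (\pi_(circle R) a)%qT.

Section circle_topology.
Variable R : realType.

Definition circle_open (A : set (circle R)) : Prop :=
  open (@circle_pi R @^-1` A).

Let circle_openT : circle_open setT.
Proof. by rewrite /circle_open preimage_setT; exact: openT. Qed.

Let circle_openI (A B : set (circle R)) :
  circle_open A -> circle_open B -> circle_open (A `&` B).
Proof. by rewrite /circle_open preimage_setI; exact: openI. Qed.

Let circle_open_bigU (I : Type) (F : I -> set (circle R)) :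
  (forall i, circle_open (F i)) -> circle_open (\bigcup_i F i).
Proof.
by move=> oF; rewrite /circle_open preimage_bigcup; apply: bigcup_open => i _; exact: oF.
Qed.

HB.instance Definition _ := isOpenTopological.Build (circle R)
  circle_openT circle_openI circle_open_bigU.

End circle_topology.

HB.instance Definition _ (R : realType) :=
  isPointed.Build (circle R) 0.
HB.instance Definition _ (R : realType) :=
  Measurable.copy (circle R) (g_sigma_algebraType (@open (circle R))).


Section circle_theory.
Variable R : realType.
Implicit Types (a b : R) (x y : circle R).

Lemma circle_piD a b : circle_pi (a + b) = circle_pi a + circle_pi b.
Proof. by rewrite /circle_pi raddfD. Qed.

Lemma circle_piP a b : reflect (circle_pi a = circle_pi b) (a - b \is a Num.int).
Proof.
suff -> : (a - b \is a Num.int) = (circle_pi a == circle_pi b) by exact: eqP.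
exact: (@Quotient.idealrBE R
  [the zmodClosed R of (@Num.int_num_subdef R : {pred R})]).
Qed.

Lemma circle_pi_int (k : int) : circle_pi k%:~R = 0 :> circle R.
Proof.
have -> : 0 = circle_pi 0 :> circle R by rewrite /circle_pi raddf0.
by apply/circle_piP; rewrite subr0 intr_int.
Qed.

Lemma circle_pi_measurable : measurable_fun setT (@circle_pi R).
Proof.
apply: (@measurability _ _ _ _ setT (@circle_pi R) (@open (circle R))) => //.
move=> _ [B oB <-]; rewrite setTI; exact: open_measurable.
Qed.

HB.instance Definition _ :=
  isMeasurableFun.Build _ _ (measurableTypeR R) (circle R) (@circle_pi R)
    circle_pi_measurable.

(* The representative in [0, 1[; unlike [repr], it is measurable. *)
Definition circle_frac x : R := repr x - (Num.floor (repr x))%:~R.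

Lemma circle_fracK : cancel circle_frac (@circle_pi R).
Proof.
move=> x; transitivity (circle_pi (repr x)); last exact: reprK.
by apply/circle_piP; rewrite /circle_frac addrAC subrr add0r rpredN intr_int.
Qed.

Lemma circle_frac_itv x : 0 <= circle_frac x < 1.
Proof.
have /andP[h1 h2] := floor_itv (repr x).
by rewrite subr_ge0 h1 ltrBlDl -(intrD _ _ 1).
Qed.

Lemma circle_frac_pi a : circle_frac (circle_pi a) = a - (Num.floor a)%:~R.
Proof.
set u := circle_frac _; have /circle_piP/intrP[k ka] := circle_fracK (circle_pi a).
have -> : a = u - k%:~R by rewrite -ka opprB addrC subrK.
have := circle_frac_itv (circle_pi a); rewrite -/u => /andP[u0 u1].
suff -> : Num.floor (u - k%:~R) = - k by rewrite mulrNz opprK subrK.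
by apply/eqP; rewrite floor_eq intrD !mulrNz; apply/andP; split; lra.
Qed.

Lemma circle_frac_measurable : measurable_fun setT circle_frac.
Proof.
apply: (measurability _ (RGenOInfty.measurableE R)) => //.
move=> _ [_ [a ->] <-]; rewrite setTI.
have [a0|a0] := ltP a 0.
  rewrite (_ : _ @^-1` _ = setT)//; apply/seteqP; split => // x _ /=.
  by rewrite in_itv/= andbT (lt_le_trans a0)//; have /andP[] := circle_frac_itv x.
apply: sub_sigma_algebra; rewrite /open/= /circle_open.
rewrite (_ : _ @^-1` _ = \bigcup_(k : int) `]k%:~R + a, k%:~R + 1[%classic).
  by apply: bigcup_open => k _; exact: interval_open.
apply/seteqP; split => [r /=|r [k _] /=]; rewrite !in_itv/= ?andbT circle_frac_pi.
  rewrite ltrBrDl => ar; exists (Num.floor r) => //=.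
  by rewrite in_itv/= ar -(intrD _ _ 1) floorD1_gt.
move=> /andP[kr rk].
suff -> : Num.floor r = k by rewrite ltrBrDl.
by apply/eqP; rewrite floor_eq intrD rk andbT (le_trans _ (ltW kr))// lerDl.
Qed.

End circle_theory.

Section circle_maps.
Variable R : realType.
Implicit Type x : circle R.

Definition doubling x : circle R := x + x.

Lemma doubling_measurable : measurable_fun setT doubling.
Proof.
rewrite (_ : doubling = @circle_pi R \o (fun x => circle_frac x + circle_frac x)).
  apply: (measurableT_comp (@circle_pi_measurable R)).
  by apply: measurable_funD; exact: circle_frac_measurable.
by apply/funext => x /=; rewrite circle_piD circle_fracK.
Qed.

HB.instance Definition _ :=
  isMeasurableFun.Build _ _ (circle R) (circle R) doubling doubling_measurable.

(* The map x |-> x + v(x) mod 1. *)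
Definition id_plus (v : circle R -> R) x : circle R := x + circle_pi (v x).

Lemma id_plus_measurable (v : {mfun circle R >-> R}) :
  measurable_fun setT (id_plus v).
Proof.
rewrite (_ : id_plus v = @circle_pi R \o (fun x => circle_frac x + v x)).
  apply: (measurableT_comp (@circle_pi_measurable R)).
  by apply: measurable_funD => //; exact: circle_frac_measurable.
by apply/funext => x /=; rewrite circle_piD circle_fracK.
Qed.

HB.instance Definition _ (v : {mfun circle R >-> R}) :=
  isMeasurableFun.Build _ _ (circle R) (circle R) (id_plus v)
    (id_plus_measurable v).

(* v(x/2) + v((x+1)/2); independent of the representative of x, see
   [transfer_pi]. *)
Definition transfer (v : circle R -> R) x : R :=
  v (circle_pi (repr x / 2)) + v (circle_pi ((repr x + 1) / 2)).

Lemma transfer_pi (v : circle R -> R) (a : R) :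
  transfer v (circle_pi a) = v (circle_pi (a / 2)) + v (circle_pi ((a + 1) / 2)).
Proof.
rewrite /transfer.
have /circle_piP/intrP[k ka] : circle_pi (repr (circle_pi a)) = circle_pi a.
  exact: reprK.
set b := repr _ in ka *; have -> : b = a + k%:~R by rewrite -ka addrC subrK.
have shift (c : R) (m : int) : circle_pi (c + m%:~R) = circle_pi c.
  by rewrite circle_piD circle_pi_int addr0.
have [m [kE|kE]] : exists m : int, k = m * 2 \/ k = m * 2 + 1.
  exists (divz k 2); have := divz_eq k 2.
  have := modz_ge0 k (isT : (2 : int) != 0); have := ltz_pmod k (isT : 0 < 2 :> int).
  by move: (modz k 2) => r; lia.
- congr (v _ + v _); rewrite -[RHS](shift _ m); congr circle_pi;
    by rewrite kE intrM; field.
- rewrite addrC; congr (v _ + v _).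
    rewrite -[RHS](shift _ (m + 1)); congr circle_pi.
    by rewrite kE !intrD intrM; field.
  rewrite -[RHS](shift _ m); congr circle_pi.
  by rewrite kE !intrD intrM; field.
Qed.

Lemma transfer_measurable (v : {mfun circle R >-> R}) :
  measurable_fun setT (transfer v).
Proof.
rewrite (_ : transfer v = fun x => v (circle_pi (circle_frac x / 2)) +
    v (circle_pi ((circle_frac x + 1) / 2))).
  have mf := @circle_frac_measurable R.
  apply: measurable_funD; apply: measurableT_comp => //;
    apply: (measurableT_comp (@circle_pi_measurable R)).
    exact: measurable_funM.
  by apply: measurable_funM => //; exact: measurable_funD.
by apply/funext => x; rewrite -transfer_pi circle_fracK.
Qed.

HB.instance Definition _ (v : {mfun circle R >-> R}) :=
  isMeasurableFun.Build _ _ (circle R) R (transfer v) (transfer_measurable v).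

End circle_maps.

Section lambda.
Variable R : realType.

Definition lebesgue01 : set (measurableTypeR R) -> \bar R :=
  mrestr lebesgue_measure (measurable_itv `[0, 1[).

HB.instance Definition _ := Measure.on lebesgue01.

Let lebesgue01_setT : lebesgue01 setT = 1%E.
Proof.
by rewrite /lebesgue01 /mrestr setTI lebesgue_measure_itv /= lte01 oppr0 adde0.
Qed.

HB.instance Definition _ :=
  Measure_isProbability.Build _ _ _ lebesgue01 lebesgue01_setT.

(* [distribution P f] is the push-forward of P by f. *)
Definition lambda : probability (circle R) R :=
  distribution lebesgue01 (@circle_pi R).

End lambda.
Arguments lambda {R}.

(* [distribution mu f] is the push-forward of [mu] by [f]. *)
Definition lambda_plus (R : realType) (v : {mfun circle R >-> R}) :
  probability (circle R) R := distribution lambda (id_plus v).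

Definition doubling_push (R : realType) (mu : probability (circle R) R) :
  probability (circle R) R := distribution mu (@doubling R).

Section L2.
Variable R : realType.

Definition L2norm (v : circle R -> R) : \bar R :=
  ('N[lambda]_(2%:E)[EFin \o v])%E.

Definition L2_0 (v : circle R -> R) : Prop :=
  v \in Lfun lambda 2%:E /\ (\int[lambda]_x (v x)%:E = 0)%E.

End L2.

Section wasserstein.
Variable R : realType.
Implicit Types mu nu : probability (circle R) R.

(* The quotient distance: infimum of |a| over the real lifts a of x - y. *)
Definition circle_dist (x y : circle R) : R :=
  inf [set `|a| | a in @circle_pi R @^-1` [set x - y]].

Definition coupling mu nu (P : probability (circle R * circle R)%type R) : Prop :=
  (forall A, measurable A -> P (A `*` setT) = mu A) /\
  (forall A, measurable A -> P (setT `*` A) = nu A).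

Definition wasserstein mu nu : \bar R :=
  sqrte (ereal_inf [set (\int[P]_z (circle_dist z.1 z.2 ^+ 2)%:E)%E
                   | P in coupling mu nu]).

End wasserstein.

(* Main.v *)
Require Import Defs.
From mathcomp Require Import all_boot all_order all_algebra.
From mathcomp Require Import all_classical all_reals all_analysis.
From HB Require Import structures.
From mathcomp Require Import ring lra measurable_realfun.
Import Order.TTheory GRing.Theory Num.Theory.
Set Implicit Arguments.
Unset Strict Implicit.
Unset Printing Implicit Defensive.
Local Open Scope classical_set_scope.
Local Open Scope ring_scope.

(* For n = 2^k comparable to 1/eps, let v(x) = -frac(2nx)/(2n) on [0, 1/2[ and
   v(x) = +frac(2nx)/(2n) on [1/2, 1[. The two values cancel in the transfer
   operator, but after doubling, half of the mass of lambda + v sits on the grid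
   (1/n)Z/Z and the other half is still uniform. Testing against the 1-Lipschitz
   distance to this grid, whose mean is 1/(4n) for lambda and 1/(8n) for the
   push-forward, bounds the Wasserstein distance below by 1/(8n).

   All integrals are computed with the identity
   [int h dlambda = 1/2 int (transfer h) dlambda] for nonnegative h. *)

(** * Integration against [lambda] through the transfer operator *)

(** The left side is the mass that [lebesgue01] gives to the ray below [a]; this is the
    self-similarity of Lebesgue measure under halving, read on rays. *)
Lemma clamp_halves (R : realFieldType) (a : R) :
  Num.min (Num.max a 0) 1 =
  2^-1 * (Num.min (Num.max (2 * a - 0) 0) 1 + Num.min (Num.max (2 * a - 1) 0) 1).
Proof.
case: (lerP a 0) => ?; case: (lerP (2 * a - 0) 0) => ?;
  case: (lerP (2 * a - 1) 0) => ?; do ![case: (lerP _ 1) => ?]; lra.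
Qed.

Section transfer_integral.
Variable R : realType.

Lemma lebesgue01_ray (a : R) :
  lebesgue01 (`]-oo, a[ : set (measurableTypeR R)) =
  (Num.min (Num.max a 0) 1)%:E.
Proof.
rewrite /lebesgue01 /mrestr.
have -> : `]-oo, a[ `&` `[0, 1[ = `[0, Num.min a 1[%classic :> set R.
  apply/seteqP; split => x /=; rewrite !in_itv/= lt_min; first by case=> -> /andP[-> ->].
  by move=> /and3P[-> -> ->].
rewrite lebesgue_measure_itv/= lte_fin; case: ifPn => [|]; rewrite lt_min ltr01 andbT.
  by move=> a0; rewrite oppr0 adde0 (max_idPl (ltW a0)).
by rewrite -leNgt => a0; rewrite (max_idPr a0) (min_idPl ler01).
Qed.

Definition half_branch (t : R) (a : measurableTypeR R) : measurableTypeR R := (a + t) / 2.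

Lemma half_branch_measurable t : measurable_fun setT (half_branch t).
Proof. by apply: measurable_funM => //; exact: measurable_funD. Qed.

HB.instance Definition _ t := isMeasurableFun.Build _ _
  (measurableTypeR R) (measurableTypeR R) (half_branch t) (half_branch_measurable t).

(** Open left rays are stable under intersection, generate the Borel sets and exhaust the line, so
    two finite measures agreeing on them coincide. On rays the identity is [clamp_halves]. *)
Lemma lebesgue01_halves (A : set (measurableTypeR R)) : measurable A ->
  lebesgue01 A = mscale (2^-1)%:nng
    (measure_add (distribution (@lebesgue01 R) (half_branch 0))
                 (distribution (@lebesgue01 R) (half_branch 1))) A.
Proof.
move=> mA.
apply: (@measure_unique _ R (measurableTypeR R) (@RGenInftyO.G R)
  (fun n => `]-oo, n%:R[%classic)) mA.
- exact: RGenInftyO.measurableE.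
- move=> _ _ [a ->] [b ->]; exists (Num.min a b).
  by apply/seteqP; split => x /=; rewrite !in_itv/= lt_min => /andP.
- by move=> n; exists n%:R.
- apply/seteqP; split=> // x _; exists (Num.truncn x).+1 => //=.
  by rewrite in_itv/= truncnS_gt.
- move=> _ [a ->].
  rewrite /= /mscale.
  rewrite [X in (_ * X)%E](measure_addE (distribution (@lebesgue01 R) (half_branch 0))
    (distribution (@lebesgue01 R) (half_branch 1))) /distribution /pushforward.
  have ray t : half_branch t @^-1` `]-oo, a[ = `]-oo, 2 * a - t[%classic.
    apply/seteqP; split => x /=;
      by rewrite !in_itv/= /half_branch ltr_pdivrMr ?ltr0n// ltrBrDr mulrC.
  rewrite /= !ray !lebesgue01_ray -EFinD -EFinM; congr _%:E.
  exact: clamp_halves.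
- by move=> n; rewrite (le_lt_trans (probability_le1 _ _)) ?ltry//; exact: measurable_itv.
Qed.

Lemma integral_lambdaE (h : circle R -> R) : measurable_fun setT h -> (forall x, 0 <= h x) ->
  (\int[lambda]_x (h x)%:E = \int[@lebesgue01 R]_a (h (circle_pi a))%:E)%E.
Proof.
move=> mh h0; rewrite /lambda ge0_integral_distribution//.
by apply/measurable_EFinP.
Qed.

Lemma measurable_transfer (h : circle R -> R) :
  measurable_fun setT h -> measurable_fun setT (transfer h).
Proof.
move=> mh.
pose h' : {mfun circle R >-> R} := HB.pack h (isMeasurableFun.Build _ _ _ _ h mh).
exact: (transfer_measurable h').
Qed.

(** A change of variables in [lebesgue01_halves]: composing [h] with the branches [a / 2] and
    [(a + 1) / 2] gives the two summands of [transfer h]. *)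
Lemma integral_transfer (h : circle R -> R) : measurable_fun setT h -> (forall x, 0 <= h x) ->
  (\int[lambda]_x (h x)%:E = (2^-1)%:E * \int[lambda]_x (transfer h x)%:E)%E.
Proof.
move=> mh h0.
have mhp : measurable_fun setT (fun a : measurableTypeR R => (h (circle_pi a))%:E).
  by apply/measurable_EFinP; apply: (measurableT_comp mh); exact: circle_pi_measurable.
rewrite !integral_lambdaE//; [|exact: measurable_transfer|]; last first.
  by move=> x; rewrite addr_ge0.
rewrite (eq_measure_integral _ (fun A mA _ => lebesgue01_halves mA)).
have hp0 (t : measurableTypeR R) : setT t -> (0 <= (h (circle_pi t))%:E)%E.
  by rewrite lee_fin.
rewrite ge0_integral_mscale// ge0_integral_measure_add//.
rewrite !ge0_integral_distribution//; last 2 first.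
- by move=> x; rewrite lee_fin.
- by move=> x; rewrite lee_fin.
congr (_ * _)%E.
rewrite -ge0_integralD//; last 4 first.
- by move=> x _; rewrite lee_fin.
- by apply: measurableT_comp mhp _; exact: half_branch_measurable.
- by move=> x _; rewrite lee_fin.
- by apply: measurableT_comp mhp _; exact: half_branch_measurable.
by apply: eq_integral => a _; rewrite transfer_pi -EFinD /= /half_branch addr0.
Qed.

End transfer_integral.

(** * The quotient distance on the circle *)

Section circle_distance.
Variable R : realType.
Implicit Types (x y z : circle R) (a : R).

Lemma circle_piMn a n : circle_pi (a *+ n) = circle_pi a *+ n.
Proof. by rewrite /circle_pi raddfMn. Qed.

Lemma circle_piN a : circle_pi (- a) = - circle_pi a.
Proof. by rewrite /circle_pi raddfN. Qed.

Lemma circle_dist_le x y a : circle_pi a = x - y -> circle_dist x y <= `|a|.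
Proof.
move=> ha; apply: ge_inf; last by exists a.
by exists 0 => _ [b _ <-].
Qed.

(** With [t] the fractional part of [x - y], the lifts are [t + k]. Those with [k >= 0] have
    absolute value at least [t], those with [k <= -1] at least [1 - t], and both bounds are
    attained. *)
Lemma circle_distE x y :
  circle_dist x y = Num.min (circle_frac (x - y)) (1 - circle_frac (x - y)).
Proof.
set t := circle_frac _; have /andP[t0 t1] : 0 <= t < 1 := circle_frac_itv _.
have tK : circle_pi t = x - y := circle_fracK _.
apply/eqP; rewrite eq_le le_min; apply/andP; split; first (apply/andP; split).
- by rewrite -(ger0_norm t0); exact: circle_dist_le.
- have <- : `|1 - t| = 1 - t by rewrite ger0_norm// subr_ge0 ltW.
  rewrite distrC; apply: circle_dist_le.
  rewrite -tK; apply/circle_piP.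
  by rewrite addrAC subrr add0r rpredN1.
- apply: lb_le_inf; first by exists `|t|, t.
  move=> _ [b /= hb <-]; have /circle_piP/intrP[k kE] : circle_pi b = circle_pi t.
    by rewrite tK.
  have {kE} -> : b = t + k%:~R by rewrite -kE addrC subrK.
  have [k0|k0] := leP 0 k.
    have k0' : 0 <= k%:~R :> R by rewrite ler0z.
    by rewrite ge_min (ger0_norm (addr_ge0 t0 k0')) lerDl k0'.
  have k1 : k%:~R <= -1 :> R by rewrite -(mulrNz 1 1) ler_int -ltzD1 addNr.
  by rewrite ge_min (@ler0_norm _ (t + k%:~R)); [apply/orP; right|]; lra.
Qed.

Lemma circle_dist_ge0 x y : 0 <= circle_dist x y.
Proof.
have /andP[? ?] := circle_frac_itv (x - y).
by rewrite circle_distE le_min; apply/andP; split; lra.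
Qed.

Lemma circle_distxx x : circle_dist x x = 0.
Proof.
apply/eqP; rewrite eq_le circle_dist_ge0 andbT -(normr0 R).
by apply: circle_dist_le; rewrite subrr /circle_pi raddf0.
Qed.

Lemma circle_dist_lift x y : exists2 a, circle_pi a = x - y & circle_dist x y = `|a|.
Proof.
have /andP[t0 t1] := circle_frac_itv (x - y); rewrite circle_distE.
case: leP => _; first by exists (circle_frac (x - y)); rewrite ?circle_fracK ?ger0_norm.
exists (circle_frac (x - y) - 1); last by rewrite distrC ger0_norm// subr_ge0 ltW.
rewrite -[RHS]circle_fracK; apply/circle_piP.
by rewrite addrAC subrr add0r rpredN1.
Qed.

(** If [a] is a shortest lift of [x - y] and [b] one of [x *+ n], then [b - a *+ n] lifts [y *+ n],
    and the real triangle inequality applies. *)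
Lemma circle_dist_mulrn_le x y n :
  circle_dist (y *+ n) 0 <= circle_dist (x *+ n) 0 + circle_dist x y *+ n.
Proof.
have [a ha ->] := circle_dist_lift x y.
have [b hb ->] := circle_dist_lift (x *+ n) 0.
rewrite -normrMn; apply: le_trans (ler_normB _ _); apply: circle_dist_le.
by rewrite circle_piD circle_piN circle_piMn ha hb mulrnBl !subr0 opprB addrC subrK.
Qed.

Lemma circle_dist_measurable :
  measurable_fun setT (fun z : circle R * circle R => circle_dist z.1 z.2).
Proof.
have mf : measurable_fun setT (fun z : circle R * circle R => circle_frac (z.1 - z.2)).
  (* Routing the difference through real representatives reduces measurability on the product to
     that of real subtraction. *)
  rewrite (_ : (fun _ => _) = @circle_frac R \o (@circle_pi R \o
      (fun z : circle R * circle R => circle_frac z.1 - circle_frac z.2))).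
    apply: (measurableT_comp (@circle_frac_measurable R)).
    apply: (measurableT_comp (@circle_pi_measurable R)).
    by apply: measurable_funB; apply: (measurableT_comp (@circle_frac_measurable R)).
  by apply/funext => z /=; rewrite circle_piD circle_piN !circle_fracK.
rewrite (_ : (fun _ => _) = (fun z : circle R * circle R =>
    Num.min (circle_frac (z.1 - z.2)) (1 - circle_frac (z.1 - z.2)))).
  by apply: measurable_minr => //; exact: measurable_funB.
by apply/funext => z; rewrite circle_distE.
Qed.

Lemma circle_mulrn_measurable n : measurable_fun setT (fun x : circle R => x *+ n).
Proof.
rewrite (_ : (fun _ => _) = @circle_pi R \o (fun x => n%:R * circle_frac x)).
  apply: (measurableT_comp (@circle_pi_measurable R)).
  by apply: measurable_funM => //; exact: circle_frac_measurable.
by apply/funext => x /=; rewrite mulr_natl circle_piMn circle_fracK.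
Qed.

Lemma circle_dist0_measurable : measurable_fun setT (fun x : circle R => circle_dist x 0).
Proof.
rewrite (_ : (fun _ => _) = (fun x : circle R => Num.min (circle_frac x) (1 - circle_frac x))).
  have mf := @circle_frac_measurable R.
  by apply: measurable_minr => //; exact: measurable_funB.
by apply/funext => x; rewrite circle_distE subr0.
Qed.

End circle_distance.

(** * The two inverse branches of doubling *)

Section halves.
Variable R : realType.
Implicit Types (x : circle R) (h : circle R -> R).

Lemma circle_frac_id (a : R) : 0 <= a < 1 -> circle_frac (circle_pi a) = a.
Proof.
move=> a01; rewrite circle_frac_pi (_ : Num.floor a = 0) ?subr0//.
by apply/eqP; rewrite floor_eq.
Qed.

Definition lower_half x : circle R := circle_pi (circle_frac x / 2).
Definition upper_half x : circle R := circle_pi ((circle_frac x + 1) / 2).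

Lemma transferE h x : transfer h x = h (lower_half x) + h (upper_half x).
Proof. by rewrite -transfer_pi circle_fracK. Qed.

Lemma doubling_lower_half x : doubling (lower_half x) = x.
Proof. by rewrite /doubling -circle_piD -splitr circle_fracK. Qed.

Lemma doubling_upper_half x : doubling (upper_half x) = x.
Proof.
rewrite /doubling -circle_piD -splitr -[RHS]circle_fracK; apply/circle_piP.
by rewrite addrAC subrr add0r rpred1.
Qed.

Lemma circle_frac_lower_half x : circle_frac (lower_half x) = circle_frac x / 2.
Proof.
have /andP[? ?] := circle_frac_itv x.
by apply: circle_frac_id; apply/andP; split; lra.
Qed.

Lemma circle_frac_upper_half x : circle_frac (upper_half x) = (circle_frac x + 1) / 2.
Proof.
have /andP[? ?] := circle_frac_itv x.
by apply: circle_frac_id; apply/andP; split; lra.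
Qed.

End halves.

(** * Invariance of [lambda] under doubling, and means obtained by transfer *)

Section invariance.
Variable R : realType.

(** Both branches are sections of [doubling], so the transfer of [h \o doubling] is twice [h], which
    cancels the factor 1/2. *)
Lemma integral_doubling (h : circle R -> R) :
  measurable_fun setT h -> (forall x, 0 <= h x) ->
  (\int[lambda]_x (h (doubling x))%:E = \int[lambda]_x (h x)%:E)%E.
Proof.
move=> mh h0; have mhd := measurableT_comp mh (@doubling_measurable R).
rewrite (integral_transfer mhd (fun x => h0 _)).
rewrite -ge0_integralZl_EFin//; last 2 first.
- by move=> x _; rewrite lee_fin; apply: addr_ge0; exact: h0.
- by apply/measurable_EFinP; exact: measurable_transfer.
apply: eq_integral => x _; rewrite -EFinM; congr _%:E.
by rewrite transferE /= doubling_lower_half doubling_upper_half; lra.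
Qed.

Lemma integral_mul2exp k (h : circle R -> R) :
  measurable_fun setT h -> (forall x, 0 <= h x) ->
  (\int[lambda]_x (h (x *+ (2 ^ k)))%:E = \int[lambda]_x (h x)%:E)%E.
Proof.
elim: k h => [|k IH] h mh h0; first by under eq_integral do rewrite mulr1n.
rewrite -[RHS]integral_doubling//.
rewrite -[RHS](IH _ (measurableT_comp mh (@doubling_measurable R)) (fun x => h0 _)).
by apply: eq_integral => x _; rewrite /= /doubling -mulrnDr addnn -mul2n -expnS.
Qed.

Lemma integral_circle_dist0 : (\int[lambda]_x (circle_dist (x : circle R) 0)%:E = (1 / 4)%:E)%E.
Proof.
rewrite integral_transfer; last 2 first.
- exact: circle_dist0_measurable.
- by move=> x; exact: circle_dist_ge0.
under eq_integral => x _.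
  (* The nearest lift of 0 is on the left for the lower half and on the right for the upper half, so
     the distances [t / 2] and [1 - (t + 1) / 2] have constant sum. *)
  rewrite (_ : transfer _ x = 1 / 2).
    over.
  have /andP[t0 t1] := circle_frac_itv x.
  rewrite transferE !circle_distE !subr0.
  rewrite circle_frac_lower_half circle_frac_upper_half.
  by rewrite min_l ?min_r; lra.
rewrite integral_cst// [X in (_ * (_ * X))%E]probability_setT mule1 -EFinM; congr _%:E; lra.
Qed.

(** As [integral_transfer] concerns nonnegative functions, positive and negative parts are treated
    separately. The values of [v] at the two preimages of a point are opposite, so both parts have
    the same transfer, hence the same integral. *)
Lemma integral_transfer_eq0 (v : circle R -> R) :
  lambda.-integrable setT (EFin \o v) -> (forall x, transfer v x = 0) ->
  (\int[lambda]_x (v x)%:E = 0)%E.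
Proof.
move=> iv tv0; have mv : measurable_fun setT v.
  by apply/measurable_EFinP; exact: measurable_int iv.
have mmax (w : circle R -> R) : measurable_fun setT w ->
    measurable_fun setT (fun x => Num.max (w x) 0).
  by move=> mw; exact: measurable_maxr.
rewrite integralE.
have -> : (\int[lambda]_x (EFin \o v)^\- x = \int[lambda]_x (EFin \o v)^\+ x)%E.
  transitivity (\int[lambda]_x (Num.max (- v x) 0)%:E)%E.
    by apply: eq_integral => x _; rewrite funenegE /= EFin_max.
  transitivity (\int[lambda]_x (Num.max (v x) 0)%:E)%E; last first.
    by apply: eq_integral => x _; rewrite funeposE /= EFin_max.
  rewrite integral_transfer; last 2 first.
  - by apply: mmax; exact: measurable_funN.
  - by move=> x; rewrite le_max lexx orbT.
  rewrite [RHS]integral_transfer; last 2 first.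
  - exact: mmax.
  - by move=> x; rewrite le_max lexx orbT.
  congr (_ * _)%E; apply: eq_integral => x _; congr _%:E.
  have /eqP := tv0 x; rewrite /transfer addr_eq0 => /eqP ->.
  by rewrite opprK addrC.
(* Integrability makes the common value finite, which excludes an infinite difference. *)
by rewrite subee// integrable_pos_fin_num.
Qed.

End invariance.

(** * Lower bounds on [wasserstein] from Lipschitz test functions *)

Section duality.
Variable R : realType.

Lemma integral_marginal d d' (T : measurableType d) (T' : measurableType d')
    (P : probability T R) (mu : probability T' R) (phi : T -> T') (f : T' -> \bar R) :
  measurable_fun setT phi -> (forall A, measurable A -> P (phi @^-1` A) = mu A) ->
  measurable_fun setT f -> (forall x, 0 <= f x)%E ->
  (\int[P]_z f (phi z) = \int[mu]_x f x)%E.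
Proof.
move=> mphi Pmu mf f0.
pose X : {RV P >-> T'} := HB.pack phi (isMeasurableFun.Build _ _ _ _ phi mphi).
rewrite -(ge0_integral_distribution X mf f0).
by apply: eq_measure_integral => A mA _; exact: Pmu.
Qed.

Lemma coupling_integral (mu nu : probability (circle R) R)
    (P : probability (circle R * circle R)%type R) (f : circle R -> \bar R) :
  coupling mu nu P -> measurable_fun setT f -> (forall x, 0 <= f x)%E ->
  (\int[P]_z f z.1 = \int[mu]_x f x)%E /\ (\int[P]_z f z.2 = \int[nu]_x f x)%E.
Proof.
move=> [P1 P2] mf f0; split; apply: integral_marginal => //.
- by move=> A mA; rewrite -P1// setXT.
- by move=> A mA; rewrite -P2// setTX.
Qed.

(** The easy half of Kantorovich duality. In place of Cauchy-Schwarz, the pointwise bound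
    [2ad <= d^2 + a^2] is integrated against a coupling; the choice [a = q - p] makes it sharp. *)
Lemma wasserstein_ge (mu nu : probability (circle R) R) (f : circle R -> R) (p q : R) :
  measurable_fun setT f -> (forall x, 0 <= f x) ->
  (forall x y, f y <= f x + circle_dist x y) ->
  (\int[mu]_x (f x)%:E = p%:E)%E -> (\int[nu]_x (f x)%:E = q%:E)%E -> p <= q ->
  ((q - p)%:E <= wasserstein mu nu)%E.
Proof.
move=> mf f0 fL fp fq pq; set a := q - p.
have a0 : 0 <= a by rewrite subr_ge0.
suff inf_ge : ((a ^+ 2)%:E <= ereal_inf [set (\int[P]_z (circle_dist z.1 z.2 ^+ 2)%:E)%E
                   | P in coupling mu nu])%E.
  have -> : a%:E = sqrte (a ^+ 2)%:E by rewrite /= sqrtr_sqr ger0_norm.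
  by rewrite lee_sqrt// (le_trans _ inf_ge)// lee_fin sqr_ge0.
apply: le_ereal_inf_tmp => _ [P cP <-].
have mfE : measurable_fun setT (EFin \o f) by apply/measurable_EFinP.
have f0E x : (0 <= (EFin \o f) x)%E by rewrite lee_fin.
have [] := coupling_integral cP mfE f0E.
rewrite [X in _ = X -> _]fp [X in _ -> _ = X -> _]fq => P1 P2.
have mf1 : measurable_fun setT (fun z : circle R * circle R => (f z.1)%:E).
  by apply/measurable_EFinP; exact: measurableT_comp mf measurable_fst.
have mf2 : measurable_fun setT (fun z : circle R * circle R => (f z.2)%:E).
  by apply/measurable_EFinP; exact: measurableT_comp mf measurable_snd.
have md : measurable_fun setT (fun z : circle R * circle R => (circle_dist z.1 z.2 ^+ 2)%:E).
  by apply/measurable_EFinP; apply: measurable_funX; exact: circle_dist_measurable.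
(* The term in [f z.1] stands on the right so that all terms are nonnegative and the integrals split
   even if the cost is infinite. *)
have : (\int[P]_z ((2 * a)%:E * (f z.2)%:E) <=
    \int[P]_z ((circle_dist z.1 z.2 ^+ 2)%:E + ((2 * a)%:E * (f z.1)%:E + (a ^+ 2)%:E)))%E.
  apply: ge0_le_integral => //.
  - by move=> z _; rewrite -EFinM lee_fin !mulr_ge0.
  - exact: measurable_funeM.
  - apply: emeasurable_funD => //; apply: emeasurable_funD => //.
    exact: measurable_funeM.
  - move=> z _; rewrite -!EFinM -!EFinD lee_fin.
    have := fL z.1 z.2; set d := circle_dist _ _ => fd.
    have : 0 <= (d - a) ^+ 2 by exact: sqr_ge0.
    have : a * f z.2 <= a * (f z.1 + d) by rewrite ler_wpM2l.
    by rewrite sqrrB mulrDr -!mulrA; lra.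
have a20 : 0 <= 2 * a by rewrite mulr_ge0.
have f10 (z : circle R * circle R) : setT z -> (0 <= (f z.1)%:E)%E by rewrite lee_fin.
have f20 (z : circle R * circle R) : setT z -> (0 <= (f z.2)%:E)%E by rewrite lee_fin.
have d0 (z : circle R * circle R) : setT z -> (0 <= (circle_dist z.1 z.2 ^+ 2)%:E)%E.
  by rewrite lee_fin sqr_ge0.
have c0 (z : circle R * circle R) : setT z -> (0 <= (a ^+ 2)%:E)%E.
  by rewrite lee_fin sqr_ge0.
have cf0 (z : circle R * circle R) : setT z -> (0 <= (2 * a)%:E * (f z.1)%:E)%E.
  by rewrite -EFinM lee_fin mulr_ge0.
have mcf : measurable_fun setT (fun z : circle R * circle R => ((2 * a)%:E * (f z.1)%:E)%E).
  exact: measurable_funeM.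
rewrite (ge0_integralZl_EFin _ _ f20)//.
rewrite (ge0_integralD _ _ d0)//; last 2 first.
- by move=> z _; apply: adde_ge0; [exact: cf0|exact: (c0 z)].
- exact: emeasurable_funD.
rewrite (ge0_integralD _ _ cf0)// (ge0_integralZl_EFin _ _ f10)//.
rewrite integral_cst// [X in ((a ^+ 2)%:E * X)%E]probability_setT mule1.
rewrite [X in (_ * X <= _)%E]P2 [X in (_ * X + _)%E]P1.
(* For a finite cost [r], the inequality reads [2aq <= r + 2ap + a^2], that is [a^2 <= r]. *)
case: (\int[P]_z _)%E => [r||].
- by rewrite -!EFinM -!EFinD !lee_fin /a; nra.
- by move=> _; rewrite leey.
- by rewrite -!EFinM addNye leeNy_eq.
Qed.

(** * Bounded functions in L2 *)

Lemma L2norm_le (v : circle R -> R) (K : R) : measurable_fun setT v ->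
  (forall x, `|v x| <= K) -> (L2norm v <= K%:E)%E.
Proof.
move=> mv vK; have K0 : 0 <= K by exact: le_trans (vK 0).
have intK : (\int[lambda]_x (`|(v x)%:E| `^ 2) <= (K ^+ 2)%:E)%E.
  under eq_integral do rewrite abse_EFin poweR_EFin powR_mulrn//.
  rewrite -[leRHS]mule1 -(@probability_setT _ _ _ (@lambda R)) -integral_cst//.
  apply: ge0_le_integral => //.
  - by apply/measurable_EFinP; apply: measurable_funX; exact: measurableT_comp.
  - by move=> x _; rewrite lee_fin; apply: lerXn2r (vK x); rewrite nnegrE.
rewrite /L2norm Lnorm.unlock poweR12_sqrt; last by apply: integral_ge0 => x _; exact: poweR_ge0.
have -> : K%:E = sqrte (K ^+ 2)%:E by rewrite /= sqrtr_sqr ger0_norm.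
by rewrite lee_sqrt// lee_fin sqr_ge0.
Qed.

Lemma bounded_Lfun2 (v : circle R -> R) (K : R) : measurable_fun setT v ->
  (forall x, `|v x| <= K) -> v \in Lfun lambda 2%:E.
Proof.
move=> mv vK; rewrite inE; apply/andP; split; rewrite inE//=.
by rewrite /finite_norm (le_lt_trans (L2norm_le mv vK))// ltry.
Qed.

End duality.

(** * The sawtooth field and its test function *)

Section sawtooth.
Variables (R : realType) (k : nat).
Let n := (2 ^ k)%N.
Implicit Types (x : circle R).

Let n_gt0 : 0 < n%:R :> R.
Proof. by rewrite ltr0n expn_gt0. Qed.

(** The fractional part depends on [doubling x] only, so it is shared by the two preimages of a
    point, where only the sign differs. *)
Definition sawtooth x : R :=
  (if circle_frac x < 1 / 2 then -1 else 1) * (circle_frac (doubling x *+ n) / (2 * n%:R)).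

Lemma sawtooth_measurable : measurable_fun setT sawtooth.
Proof.
have mf := @circle_frac_measurable R.
apply: measurable_funM.
  by apply: measurable_fun_ifT => //; exact: measurable_fun_ltr.
apply: measurable_funM => //; apply: (measurableT_comp mf).
exact: (measurableT_comp (@circle_mulrn_measurable R n) (@doubling_measurable R)).
Qed.

HB.instance Definition _ :=
  isMeasurableFun.Build _ _ (circle R) R sawtooth sawtooth_measurable.

Lemma sawtooth_lower_half x :
  sawtooth (lower_half x) = - (circle_frac (x *+ n) / (2 * n%:R)).
Proof.
have /andP[_ x1] := circle_frac_itv x.
rewrite /sawtooth doubling_lower_half circle_frac_lower_half.
by rewrite ifT ?mulN1r// ltr_pM2r// invr_gt0.
Qed.

Lemma sawtooth_upper_half x :
  sawtooth (upper_half x) = circle_frac (x *+ n) / (2 * n%:R).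
Proof.
have /andP[x0 _] := circle_frac_itv x.
rewrite /sawtooth doubling_upper_half circle_frac_upper_half.
by rewrite ifF ?mul1r//; apply/negbTE; rewrite -leNgt; lra.
Qed.

Lemma transfer_sawtooth x : transfer sawtooth x = 0.
Proof. by rewrite transferE sawtooth_lower_half sawtooth_upper_half addNr. Qed.

Lemma sawtooth_le x : `|sawtooth x| <= (2 * n%:R)^-1.
Proof.
have /andP[t0 /ltW t1] := circle_frac_itv (doubling x *+ n).
have nV : 0 <= (2 * n%:R : R)^-1 by rewrite invr_ge0 mulr_ge0// ltW.
rewrite /sawtooth normrM (_ : `|if _ then _ else _| = 1) ?mul1r; last first.
  by case: ifP; rewrite ?normrN1 ?normr1.
by rewrite ger0_norm ?mulr_ge0// ler_piMl.
Qed.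

(** The distance from [x] to the [n]-torsion subgroup of the circle, that is, to the grid of
    multiples of 1/n. *)
Definition torsion_dist x : R := circle_dist (x *+ n) 0 / n%:R.

Lemma torsion_dist_ge0 x : 0 <= torsion_dist x.
Proof. by rewrite divr_ge0 ?circle_dist_ge0 ?ltW. Qed.

Lemma torsion_dist_measurable : measurable_fun setT torsion_dist.
Proof.
apply: measurable_funM => //.
exact: (measurableT_comp (@circle_dist0_measurable R) (@circle_mulrn_measurable R n)).
Qed.

Lemma torsion_dist_lipschitz x y :
  torsion_dist y <= torsion_dist x + circle_dist x y.
Proof.
rewrite /torsion_dist ler_pdivrMr// mulrDl divfK ?gt_eqF// mulr_natr.
exact: circle_dist_mulrn_le.
Qed.

Lemma integral_torsion_dist :
  (\int[lambda]_x (torsion_dist x)%:E = ((4 * n%:R)^-1)%:E)%E.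
Proof.
under eq_integral do rewrite /torsion_dist mulrC EFinM.
rewrite ge0_integralZl_EFin//; last 2 first.
- by move=> x _; rewrite lee_fin circle_dist_ge0.
- apply/measurable_EFinP.
  exact: (measurableT_comp (@circle_dist0_measurable R) (@circle_mulrn_measurable R n)).
(* Here [n] being a power of 2 is used: multiplication by [n] iterates doubling and preserves
   [lambda]. *)
rewrite (integral_mul2exp k (@circle_dist0_measurable R)) => [|x]; last exact: circle_dist_ge0.
by rewrite integral_circle_dist0 -EFinM; congr _%:E; rewrite invfM mulrC mul1r.
Qed.

(* With z = 2nx, multiplying 2(x + sawtooth x) by n gives z - frac z = 0 on the lower
   half of the circle, and z + frac z = 2z on the upper half. *)
Lemma integral_torsion_dist_sawtooth :
  (\int[doubling_push (lambda_plus sawtooth)]_x (torsion_dist x)%:E = ((8 * n%:R)^-1)%:E)%E.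
Proof.
have mt := torsion_dist_measurable.
have mtE : measurable_fun setT (EFin \o torsion_dist) by apply/measurable_EFinP.
rewrite /doubling_push ge0_integral_distribution//; last first.
  by move=> x; rewrite lee_fin torsion_dist_ge0.
rewrite /lambda_plus ge0_integral_distribution//; last 2 first.
- exact: measurableT_comp mtE (@doubling_measurable R).
- by move=> x; rewrite lee_fin torsion_dist_ge0.
pose h x := torsion_dist (doubling (id_plus sawtooth x)).
have mh : measurable_fun setT h.
  apply: (measurableT_comp mt); apply: (measurableT_comp (@doubling_measurable R)).
  exact: (id_plus_measurable sawtooth).
rewrite (integral_transfer mh); last by move=> x; exact: torsion_dist_ge0.
have th x : transfer h x = torsion_dist (doubling x).
  have shift y (s : R) : doubling (y + circle_pi (s / (2 * n%:R))) *+ n =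
      doubling y *+ n + circle_pi s.
    rewrite /doubling addrACA mulrnDl -circle_piD -circle_piMn; congr (_ + circle_pi _).
    by rewrite -mulr_natr; field; rewrite gt_eqF.
  rewrite transferE /h /id_plus sawtooth_lower_half sawtooth_upper_half /torsion_dist.
  rewrite -mulNr !shift doubling_lower_half doubling_upper_half.
  rewrite circle_piN !circle_fracK subrr -mulrnDl.
  by rewrite circle_distxx mul0r add0r.
under eq_integral do rewrite th.
rewrite (integral_doubling mt torsion_dist_ge0) integral_torsion_dist -EFinM; congr _%:E.
by field; rewrite gt_eqF.
Qed.

Lemma wasserstein_sawtooth :
  (((8 * n%:R)^-1)%:E <= wasserstein (doubling_push (lambda_plus sawtooth)) lambda)%E.
Proof.
have -> : (8 * n%:R)^-1 = (4 * n%:R)^-1 - (8 * n%:R)^-1 :> R.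
  by field; rewrite gt_eqF.
apply: (wasserstein_ge torsion_dist_measurable torsion_dist_ge0 torsion_dist_lipschitz).
- exact: integral_torsion_dist_sawtooth.
- exact: integral_torsion_dist.
- by rewrite lef_pV2 ?posrE ?mulr_gt0// ler_pM2r// ler_nat.
Qed.

(** Boundedness gives L2, hence L1 since [lambda] is finite; the vanishing transfer then forces mean
    zero. *)
Lemma L2_0_sawtooth : L2_0 sawtooth.
Proof.
have sL := bounded_Lfun2 sawtooth_measurable sawtooth_le.
split => //; apply: integral_transfer_eq0 transfer_sawtooth.
apply/Lfun1_integrable; apply: Lfun_subset12 sL.
exact: fin_num_measure.
Qed.

End sawtooth.

(** * Choice of the scale and conclusion *)

(** Take the least [k] satisfying the first bound: for [k > 0], its failure at [k - 1] is the second
    bound. For [k = 0] minimality says nothing, hence the alternative. *)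
Lemma dyadic_scale (R : realType) (eps : R) : 0 < eps ->
  exists k : nat, (2 * (2 ^ k)%:R)^-1 <= eps /\ (k = 0%N \/ eps <= (2 ^ k)%:R^-1).
Proof.
move=> e0; have exk : exists k, (2 * (2 ^ k)%:R)^-1 <= eps.
  (* With [m] this witness, [eps^-1 < m < 2 ^ m <= 2 * 2 ^ m]. *)
  exists (Num.truncn eps^-1).+1.
  rewrite invf_ple ?posrE ?mulr_gt0 ?ltr0n ?expn_gt0//.
  rewrite (le_trans (ltW (truncnS_gt _)))// -natrM ler_nat -expnS.
  by rewrite (leq_trans (ltnW (ltn_expl _ (isT : (1 < 2)%N))))// leq_exp2l.
case: (ex_minnP exk) => k kP kmin; exists k; split=> //.
case: k kP kmin => [|k] kP kmin; [by left|right].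
rewrite ltW// expnS natrM ltNge; apply/negP => /kmin.
by rewrite ltnn.
Qed.

(* The circle has diameter 1/2, so a lower bound c * eps on the Wasserstein
   distance with c independent of eps can only hold on bounded ranges of eps;
   the bound eps0 of the range is arbitrary. *)
Theorem proposition4p3 (R : realType) (eps0 : R) (heps0 : 0 < eps0) :
  exists c : R, 0 < c /\
  forall eps : R, 0 < eps -> eps <= eps0 ->
  exists v : {mfun circle R >-> R},
    [/\ L2_0 v,
        (L2norm v <= eps%:E)%E,
        transfer v = cst 0 %[ae lambda],
        (forall A : set (circle R), measurable A ->
          lambda_plus (transfer v) A = lambda A) &
        ((c * eps)%:E <= wasserstein (doubling_push (lambda_plus v)) lambda)%E].
Proof.
(* The 1/8 comes from [wasserstein_sawtooth]. The minimum makes [8 * c * eps] at most 1/n: through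
   [1] when [eps <= 1/n], and through [eps0^-1] when [k = 0], where [n = 1] and [eps <= eps0]. *)
exists (Num.min 1 eps0^-1 / 8); split; first by rewrite divr_gt0// lt_min ltr01 invr_gt0.
move=> eps e0 ee; have [k [kle kge]] := dyadic_scale e0.
exists (sawtooth (R:=R) k); split.
- exact: L2_0_sawtooth.
- apply: L2norm_le; first exact: sawtooth_measurable.
  by move=> x; exact: le_trans (sawtooth_le _ _) kle.
- by apply: aeW => x _; exact: transfer_sawtooth.
(* The transfer vanishes at every point, so [id_plus] of it is the identity map. *)
- move=> A mA; rewrite /lambda_plus /distribution /pushforward /=; congr (lambda _).
  apply/seteqP; split=> x /=;
    by rewrite /id_plus transfer_sawtooth (circle_pi_int R 0) addr0.
- apply: le_trans (wasserstein_sawtooth _ _).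
  rewrite lee_fin invfM mulrAC mulrC ler_pM2l ?invr_gt0//.
  case: kge => [->|kge].
    apply: (@le_trans _ _ (eps0^-1 * eps)).
      by rewrite (ler_wpM2r (ltW e0))// ge_min lexx orbT.
    by rewrite expn0 invr1 mulrC ler_pdivrMr// mul1r.
  by apply: le_trans kge; rewrite -[leRHS]mul1r (ler_wpM2r (ltW e0))// ge_min lexx.
Qed.
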